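(* Let $p\ge2$ be a prime, let $r\ge1$ be an integer, and put $\ell=p^r$. Then for each $d\ge0$, $$\prod_{s=1}^{d}[\ell]_s^{N_{\ell,d,s}}=\prod_{s=1}^{d}\prod_{\lambda\in\mathsf{Par}(s)}I^v_{p,r}(\lambda)^{u(\ell-2,d-s)}.$$
   Context: $v$ is an indeterminate and $[n]_s=\sum_{k=1}^nv^{(n+1-2k)s}\in\mathbb Z[v,v^{-1}]$. $\mathsf{Par}(n)$ is the set of partitions of $n$; $m_k(\lambda)$ is the number of parts of $\lambda$ equal to $k$. $u(m,n)$ is the number of $m$-tuples of partitions of total size $n$ (so $u(0,0)=1$ and $u(0,n)=0$ for $n\ge1$). For $n\ge1$, $\nu_p(n)\ge0$ and $a_p(n)\geq 1$ are the integers with $n=a_p(n)p^{\nu_p(n)}$ and $p\nmid a_p(n)$. $$N_{\ell,d,s}=\sum_{\lambda\in\mathsf{Par}(d)}\frac{m_s(\lambda)}{\ell-1}\prod_{u\ge1}\binom{m_u(\lambda)+\ell-2}{m_u(\lambda)}.$$ For a partition $\lambda$, $$I^v_{p,r}(\lambda)=\prod_{\substack{n\ge1\\ p^r\nmid n}}\ \prod_{k=1}^{m_n(\lambda)}[p^{\,r+\nu_p(k)-\nu_p(n)}]_{a_p(k)p^{\nu_p(n)}}.$$ *)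

(* Defs.v *)
From HB Require Import structures.
From mathcomp Require Import all_boot all_order all_algebra.

Set Implicit Arguments.
Unset Strict Implicit.
Unset Printing Implicit Defensive.

Import Order.TTheory GRing.Theory Num.Theory.

Definition is_partition (n : nat) (la : seq nat) : bool :=
  [&& sorted geq la, 0 \notin la & sumn la == n].

Record Par (n : nat) : Type :=
  MkPar { parts :> seq nat; _ : is_partition n parts }.

HB.instance Definition _ n := [isSub for @parts n].
HB.instance Definition _ n := [Countable of Par n by <:].

Lemma size_le_sumn (s : seq nat) : 0 \notin s -> size s <= sumn s.
Proof.
elim: s => //= x s IHs; rewrite inE negb_or eq_sym -lt0n => /andP[x0 /IHs le_s].
by rewrite -add1n leq_add.
Qed.

Lemma mem_le_sumn (s : seq nat) (x : nat) : x \in s -> x <= sumn s.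
Proof.
elim: s => //= y s IHs; rewrite inE => /orP[/eqP-> | /IHs le_xs].
  exact: leq_addr.
exact: leq_trans le_xs (leq_addl _ _).
Qed.

Lemma Par_size n (la : Par n) : size la <= n.
Proof. by case: la => la /= /and3P[_ /size_le_sumn ? /eqP<-]. Qed.

Lemma Par_part_le n (la : Par n) x : x \in parts la -> x <= n.
Proof. by case: la => la /= /and3P[_ _ /eqP<-]; exact: mem_le_sumn. Qed.

(* The finiteness of Par n: the parts of a partition of n form a sequence of at
   most n elements of {0, ..., n}. *)
Lemma Par_encode_subproof n (la : Par n) :
  size (map (@inord n) la) <= n.
Proof. by rewrite size_map Par_size. Qed.

Definition Par_encode n (la : Par n) : n.-bseq 'I_n.+1 :=
  Bseq (Par_encode_subproof la).

Definition Par_decode n (t : n.-bseq 'I_n.+1) : option (Par n) :=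
  insub (map val t).

Lemma Par_encodeK n : pcancel (@Par_encode n) (@Par_decode n).
Proof.
move=> la; rewrite /Par_decode /Par_encode /= -map_comp.
suff -> : [seq (val \o @inord n) i | i <- la] = parts la by rewrite valK.
by apply: map_id_in => x /Par_part_le le_xn; rewrite /= inordK.
Qed.

HB.instance Definition _ n : isFinite (Par n) := PCanIsFinite (@Par_encodeK n).

Definition mult (k : nat) (la : seq nat) : nat := count_mem k la.

(* The number of m-tuples of partitions of total size n. Each entry of such a
   tuple has size at most n, so the tuples range over a finite type. *)
Definition u (m n : nat) : nat :=
  #|[set t : m.-tuple {k : 'I_n.+1 & Par k}
      | \sum_(i < m) val (tag (tnth t i)) == n]|.

Local Open Scope ring_scope.

(* Laurent polynomials in v are computed in the field of fractions of int[v],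
   into which the ring of Laurent polynomials embeds. *)
Definition vv : {fraction {poly int}} := tofrac ('X : {poly int}).

Definition qint (n s : nat) : {fraction {poly int}} :=
  \sum_(1 <= k < n.+1) vv ^ ((n%:Z + 1 - 2 * k%:Z) * s%:Z).

(* The factors with i > d are equal to 1. *)
Definition Nexp (l d s : nat) : rat :=
  \sum_(la : Par d) (mult s la)%:R / (l - 1)%:R
     * \prod_(1 <= i < d.+1) 'C(mult i la + l - 2, mult i la)%:R.

(* Nexp is a natural number in the relevant range, so that the exponent
   Num.truncn (Nexp l d s) is Nexp l d s itself. *)
Lemma Nexp_nat (l d s : nat) :
  (2 <= l)%N -> (1 <= s <= d)%N -> Nexp l d s \is a Num.nat.
Proof.
move=> l2 sd; apply: rpred_sum => la _.
rewrite (bigD1_seq s) /= ?mem_index_iota ?iota_uniq //.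
rewrite mulrA; apply: rpredM; last first.
  by apply: rpred_prod => i _; exact: natr_nat.
case: (mult s la) => [|m]; first by rewrite mul0r mul0r rpred0.
rewrite mulrAC -natrM.
have -> : (m.+1 * 'C(m.+1 + l - 2, m.+1) = 'C(m.+1 + l - 2, m) * (l - 1))%N.
  rewrite mul_bin_left mulnC; congr (_ * _)%N.
  by rewrite addSnnS -addnBA ?leqW // addnC addnK subSS.
rewrite natrM mulfK ?natr_nat // pnatr_eq0.
by rewrite subn_eq0 -ltnNge.
Qed.

Lemma Nexp_truncn (l d s : nat) :
  (2 <= l)%N -> (1 <= s <= d)%N -> (Num.truncn (Nexp l d s))%:R = Nexp l d s.
Proof. by move=> l2 sd; apply: truncnK; exact: Nexp_nat. Qed.

(* For n >= 1 and p prime, logn p n and n`_p^' are the integers nu and a with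
   n = a * p ^ nu and p not dividing a. When p ^ r does not divide n, one has
   logn p n < r, so the subtraction below does not truncate. The factors with
   n > sumn la are empty products. *)
Definition Iv (p r : nat) (la : seq nat) : {fraction {poly int}} :=
  \prod_(1 <= n < (sumn la).+1 | ~~ (p ^ r %| n)%N)
    \prod_(1 <= k < (mult n la).+1)
      qint (p ^ (r + logn p k - logn p n)) (k`_p^' * p ^ logn p n).

(* Main.v *)
(* Write {t} = v^t - v^-t, so that [n]_s = {ns}/{s}, and let P be the generating
   function of partitions.  The generating function of N_{l,d,s} in d is
   P^(l-1) q^s / (1 - q^s), so N_{l,d,s} is the sum of u(l-1, d - sj) over
   j >= 1.  On the right-hand side, the partitions la with m_n(la) >= k have the
   generating function q^(nk) P, so the factor of I attached to (n, k) occurs with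
   exponent u(l-1, d - nk).  Both sides are thus products over N <= d of a
   product over the divisors of N, raised to the power u(l-1, d - N), and it
   remains to see that, for each N,
     prod_{nk = N, l does not divide n} {lk} / {a_p(k) p^(nu_p(n))}
       = prod_{s | N} {ls} / {s}.
   The numerators missing on the left are the {lk} with l | N/k, and these are the
   {s} with l | s; the map n |-> a_p(N/n) p^(nu_p(n)) permutes the divisors of N
   that are not divisible by l, so the denominators match the remaining {s}. *)
Require Import Defs.
From mathcomp Require Import all_boot all_order all_algebra.
From mathcomp Require Import zify ring.
Set Implicit Arguments.
Unset Strict Implicit.
Unset Printing Implicit Defensive.
Import Order.TTheory GRing.Theory Num.Theory.

(** * Partitions and their multiplicities *)

Lemma sumn_mult (D : nat) (la : seq nat) :
    0 \notin la -> all (leq^~ D) la ->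
  sumn la = \sum_(i < D) i.+1 * mult i.+1 la.
Proof.
elim: la => [|x la IH] /=; first by rewrite big1 // => i _; rewrite muln0.
rewrite inE negb_or eq_sym -lt0n => /andP[x0 la0] /andP[xD laD].
rewrite (IH la0 laD).
have -> : \sum_(i < D) i.+1 * mult i.+1 (x :: la)
  = \sum_(i < D) i.+1 * (x == i.+1) + \sum_(i < D) i.+1 * mult i.+1 la.
  by rewrite -big_split; apply: eq_bigr => i _; rewrite /mult /= mulnDr.
congr (_ + _)%N.
case: x x0 xD => // x _ xD.
rewrite (bigD1 (Ordinal xD)) //= eqxx muln1 big1 ?addn0 // => i.
by rewrite -val_eqE /= eqSS eq_sym => /negPf->; rewrite muln0.
Qed.

Lemma Par_sorted n (la : Par n) : sorted geq la.
Proof. by case: la => la /= /and3P[]. Qed.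

Lemma Par_notin0 n (la : Par n) : 0 \notin parts la.
Proof. by case: la => la /= /and3P[]. Qed.

Lemma Par_sumn n (la : Par n) : sumn la = n.
Proof. by case: la => la /= /and3P[_ _ /eqP]. Qed.

Lemma Par_mult_le n (la : Par n) k : mult k la <= n.
Proof. exact: leq_trans (count_size _ _) (Par_size la). Qed.

Lemma Par_mult_eq0 n (la : Par n) k : n < k -> mult k la = 0.
Proof.
move=> nk; apply/count_memPn; apply: contraL nk => /Par_part_le.
by rewrite -leqNgt.
Qed.

Lemma Par_sum_mult D n (la : Par n) :
  n <= D -> \sum_(i < D) i.+1 * mult i.+1 la = n.
Proof.
move=> nD; rewrite -sumn_mult ?Par_sumn ?Par_notin0 //.
by apply/allP => x /Par_part_le xn; apply: leq_trans nD.
Qed.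

(** Index [i] stands for the part size [i.+1]. For [n <= D] no multiplicity exceeds [D], so [inord]
    loses nothing and a partition becomes a point of a finite type, the one that indexes the
    expansion of a product of [D] polynomials. *)
Definition mults (D n : nat) (la : Par n) : {ffun 'I_D -> 'I_D.+1} :=
  [ffun i : 'I_D => inord (mult i.+1 la)].

Lemma multsE D n (la : Par n) i : n <= D -> mults D la i = mult i.+1 la :> nat.
Proof.
by move=> nD; rewrite ffunE inordK // ltnS (leq_trans (Par_mult_le _ _)).
Qed.

Lemma geq_trans : transitive geq.
Proof. by move=> y x z xy yz; apply: leq_trans xy. Qed.

Lemma geq_anti : antisymmetric geq.
Proof. by move=> x y; rewrite andbC => /anti_leq. Qed.

Lemma mults_inj D n : n <= D -> injective (@mults D n).
Proof.
move=> nD la mu eq_lm; apply: val_inj => /=.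
apply: (sorted_eq geq_trans geq_anti); rewrite ?Par_sorted //.
rewrite /perm_eq; apply/allP => k _ /=.
case: k => [|k].
  by rewrite !(count_memPn (Par_notin0 _)).
have [kD|Dk] := ltnP k D.
  have := congr1 val (congr1 (fun f : {ffun _ -> _} => f (Ordinal kD)) eq_lm).
  by rewrite /= !multsE // /mult /= => eq_k; apply/eqP.
by rewrite -!/(mult _ _) !Par_mult_eq0 // ltnS (leq_trans nD).
Qed.

Definition of_mults (D : nat) (f : {ffun 'I_D -> 'I_D.+1}) : seq nat :=
  sort geq (flatten [seq nseq (f i) i.+1 | i <- enum 'I_D]).

Lemma mem_of_mults D (f : {ffun 'I_D -> 'I_D.+1}) x :
  x \in of_mults f -> 0 < x <= D.
Proof.
by rewrite mem_sort => /flattenP[_ /mapP[i _ ->] /nseqP[-> _]]; rewrite ltn_ord.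
Qed.

Lemma mult_of_mults D (f : {ffun 'I_D -> 'I_D.+1}) (i : 'I_D) :
  mult i.+1 (of_mults f) = f i.
Proof.
rewrite /mult /of_mults count_sort count_flatten -map_comp sumnE big_map.
rewrite big_enum (bigD1 i) //= count_nseq /= eqxx mul1n big1 ?addn0 // => j ji.
by rewrite count_nseq /= eqSS (inj_eq val_inj) (negPf ji).
Qed.

Lemma sumn_of_mults D (f : {ffun 'I_D -> 'I_D.+1}) :
  sumn (of_mults f) = \sum_(i < D) i.+1 * f i.
Proof.
rewrite (@sumn_mult D).
- by apply: eq_bigr => i _; rewrite mult_of_mults.
- by apply/negP => /mem_of_mults.
- by apply/allP => x /mem_of_mults /andP[].
Qed.

Lemma of_mults_partition D (f : {ffun 'I_D -> 'I_D.+1}) :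
  is_partition (\sum_(i < D) i.+1 * f i) (of_mults f).
Proof.
apply/and3P; split; last by rewrite sumn_of_mults.
  by apply: sort_sorted => x y; exact: leq_total.
by apply/negP => /mem_of_mults.
Qed.

Lemma imset_mults D n : n <= D ->
  @mults D n @: [set: Par n]
    = [set f : {ffun 'I_D -> 'I_D.+1} | \sum_(i < D) i.+1 * f i == n].
Proof.
move=> nD; apply/setP => f; rewrite inE; apply/imsetP/eqP => [[la _ ->]|fn].
  by rewrite -[RHS](Par_sum_mult la nD); apply: eq_bigr => i _; rewrite multsE.
have := of_mults_partition f; rewrite fn => fP.
exists (MkPar fP); rewrite ?inE //.
by apply/ffunP => i; apply: val_inj; rewrite /= (multsE _ _ nD) mult_of_mults.
Qed.

Local Open Scope ring_scope.

(** Expanding the product chooses an exponent for every part size. The choices of total weight [n]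
    are exactly the multiplicity vectors of the partitions of [n], and truncating at degree [D]
    drops none of them because [n <= D]. *)
Lemma coef_euler_prod (R : comNzRingType) (D n : nat) (g : nat -> nat -> R) :
    (n <= D)%N ->
  (\prod_(i < D) ((\poly_(j < D.+1) g i.+1 j) \Po 'X^(i.+1)))`_n
    = \sum_(la : Par n) \prod_(i < D) g i.+1 (mult i.+1 la).
Proof.
move=> nD.
have E (i : 'I_D) : (\poly_(j < D.+1) g i.+1 j) \Po 'X^(i.+1)
   = \sum_(j < D.+1) (g i.+1 j) *: 'X^(i.+1 * j)%N.
  rewrite poly_def rmorph_sum /=; apply: eq_bigr => j _.
  by rewrite comp_polyZ rmorphXn /= comp_polyX exprM.
under eq_bigr do rewrite E.
rewrite bigA_distr_bigA /= coef_sum.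
have F (f : {ffun 'I_D -> 'I_D.+1}) :
  (\prod_(i < D) (g i.+1 (f i) *: 'X^(i.+1 * f i)))`_n
    = if (\sum_(i < D) i.+1 * f i == n)%N then \prod_(i < D) g i.+1 (f i) else 0.
  rewrite (@scaler_prod R {poly R}) prodrXr coefZ coefXn mulr_natr -mulrb.
  by rewrite eq_sym.
rewrite (eq_bigr _ (fun f _ => F f)).
rewrite -big_mkcond /=.
transitivity (\sum_(f : {ffun 'I_D -> 'I_D.+1} | f \in @mults D n @: [set: Par n])
                  \prod_(i < D) g i.+1 (f i)).
  by apply: eq_bigl => f; rewrite imset_mults // inE.
rewrite big_imset /=; last by move=> x y _ _; apply: mults_inj.
apply: eq_big => [la|la _]; first by rewrite inE.
by apply: eq_bigr => i _; rewrite multsE.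
Qed.

(** * Truncated generating functions *)

(** Congruence modulo ['X^(D.+1)]; it lets truncated polynomials play the role of power series. *)
Definition eqX (R : nzRingType) (D : nat) (p q : {poly R}) : Prop :=
  forall k, (k <= D)%N -> p`_k = q`_k.

Lemma eqX_refl (R : nzRingType) D (p : {poly R}) : eqX D p p.
Proof. by []. Qed.

Lemma eqX_sym (R : nzRingType) D (p q : {poly R}) : eqX D p q -> eqX D q p.
Proof. by move=> pq k kD; rewrite pq. Qed.

Lemma eqX_trans (R : nzRingType) D (q p r : {poly R}) :
  eqX D p q -> eqX D q r -> eqX D p r.
Proof. by move=> pq qr k kD; rewrite pq ?qr. Qed.

Lemma eqX_mul (R : nzRingType) D (p p' q q' : {poly R}) :
  eqX D p p' -> eqX D q q' -> eqX D (p * q) (p' * q').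
Proof.
move=> pp qq k kD; rewrite !coefM; apply: eq_bigr => i _.
by rewrite pp ?qq ?(leq_trans (leq_subr _ _)) // (leq_trans _ kD) // -ltnS.
Qed.

Lemma eqX_prod (R : nzRingType) (I : Type) (r : seq I) (P : pred I) D
    (F G : I -> {poly R}) :
  (forall i, P i -> eqX D (F i) (G i)) ->
  eqX D (\prod_(i <- r | P i) F i) (\prod_(i <- r | P i) G i).
Proof.
by move=> FG; elim/big_ind2: _ => // p q p' q'; exact: eqX_mul.
Qed.

Lemma eqX_exp (R : nzRingType) D m (p q : {poly R}) :
  eqX D p q -> eqX D (p ^+ m) (q ^+ m).
Proof.
by move=> pq; elim: m => // m IH; rewrite !exprS; apply: eqX_mul.
Qed.

Lemma eqX_comp (R : comNzRingType) D i (p q : {poly R}) :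
  eqX D p q -> eqX D (p \Po 'X^(i.+1)) (q \Po 'X^(i.+1)).
Proof.
move=> pq k kD; rewrite !coef_comp_poly_Xn //; case: ifP => // _.
by rewrite pq // (leq_trans (leq_div _ _)).
Qed.

Definition Par_gen (D : nat) : {poly rat} := \poly_(k < D.+1) (#|{: Par k}|)%:R.

Lemma u_coef D m n : (n <= D)%N -> (u m n)%:R = (Par_gen D ^+ m)`_n.
Proof.
move=> nD.
(* The tuples counted by [u m n] have entries of size at most [n], so the truncation is first
   lowered to [n]. *)
have /(eqX_exp m) -> // : eqX n (Par_gen D) (Par_gen n).
  move=> k kn; rewrite !coef_poly !ltnS kn.
  by rewrite (leq_trans kn nD).
(* One monomial per partition: the [m]-th power then expands over [m]-tuples of partitions. *)
have -> : Par_gen n = \sum_(x : {k : 'I_n.+1 & Par k}) 'X^(tag x).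
  rewrite /Par_gen poly_def.
  rewrite -(sig_big_dep (fun _ => true) (fun _ _ => true)
    (fun (k : 'I_n.+1) (_ : Par k) => 'X^k : {poly rat})) /=.
  by apply: eq_bigr => k _; rewrite sumr_const scaler_nat.
rewrite -{2}(card_ord m) -prodr_const bigA_distr_bigA /= coef_sum.
rewrite /u -sum1_card natr_sum.
rewrite (reindex (@finfun_of_tuple _ m)) /=; last first.
  exists (@tuple_of_finfun _ m) => t _; first exact: finfun_of_tupleK.
  exact: tuple_of_finfunK.
rewrite [LHS]big_mkcond /=; apply: eq_bigr => t _.
rewrite prodrXr coefXn inE eq_sym.
under [in RHS]eq_bigr do rewrite ffunE.
by case: ifP.
Qed.

Definition geom (D : nat) : {poly rat} := \poly_(j < D.+1) 1.

(** Euler's product for partitions: all weights are 1 in [coef_euler_prod]. *)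
Lemma Par_gen_prod D : eqX D (Par_gen D) (\prod_(i < D) (geom D \Po 'X^(i.+1))).
Proof.
move=> k kD; rewrite coef_poly ltnS kD.
rewrite (coef_euler_prod (fun _ _ => 1)) //.
by under eq_bigr do rewrite big1 //; rewrite sumr_const.
Qed.

(** Each further factor [geom D] replaces the coefficients by their partial sums, and the
    hockey-stick identity evaluates these. *)
Lemma geom_exp D m :
  eqX D (geom D ^+ m.+1) (\poly_(j < D.+1) 'C(j + m, j)%:R).
Proof.
elim: m => [|m IH].
  by move=> k kD; rewrite expr1 !coef_poly addn0 binn.
rewrite exprS; apply: (eqX_trans (eqX_mul (@eqX_refl _ D _) IH)).
move=> k kD; rewrite coefM coef_poly ltnS kD.
have E (i : 'I_k.+1) : (geom D)`_i * (\poly_(j < D.+1) 'C(j + m, j)%:R)`_(k - i)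
   = 'C(k - i + m, k - i)%:R :> rat.
  have ik : (i <= k)%N by rewrite -ltnS.
  by rewrite !coef_poly !ltnS (leq_trans ik kD) (leq_trans (leq_subr _ _)) // mul1r.
rewrite (eq_bigr _ (fun i _ => E i)) -natr_sum; congr (_%:R).
rewrite (reindex_inj rev_ord_inj) /=.
under eq_bigr => i _ do rewrite subSS subKn -1?ltnS //.
elim: k {kD E} => [|k IHk]; first by rewrite big_ord1 !bin0.
by rewrite big_ord_recr /= IHk [in RHS]addSn binS addSnnS addnC.
Qed.

(** * Generating functions of the exponents on both sides *)

Lemma prod_mul_at (R : comPzRingType) (D n : nat) (a : R) (b : nat -> R) :
  (0 < n <= D)%N ->
  \prod_(i < D) (if i.+1 == n then a * b i.+1 else b i.+1)
    = a * \prod_(i < D) b i.+1.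
Proof.
case: n => // n /= nD; rewrite (bigD1 (Ordinal nD)) //= eqxx.
rewrite [in RHS](bigD1 (Ordinal nD)) //= mulrA; congr (_ * _).
apply: eq_bigr => i; rewrite -val_eqE /= eqSS => /negPf-> //.
Qed.

Lemma geom_shift D k : eqX D (\poly_(j < D.+1) (k <= j)%N%:R) ('X^k * geom D).
Proof.
move=> j jD; rewrite coefXnM !coef_poly ltnS jD ltnS.
by rewrite (leq_trans (leq_subr _ _) jD); case: leqP.
Qed.

(** Requiring [k <= mult n la] multiplies the factor of part size [n] in Euler's product by
    ['X^(n * k)]; the [m] other partitions contribute [Par_gen d ^+ m], which gives [m.+1] partition
    series in all. *)
Lemma count_mult_geq_u m d n k : (0 < n <= d)%N -> (0 < k)%N ->
  (\sum_(1 <= t < d.+1) #|[set la : Par t | k <= mult n la]| * u m (d - t)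
    = if n * k <= d then u m.+1 (d - n * k) else 0)%N.
Proof.
move=> nd k0; apply/eqP; rewrite -(eqr_nat rat); apply/eqP.
pose g i j : rat := if i == n then (k <= j)%N%:R else 1.
pose Q := \prod_(i < d) ((\poly_(j < d.+1) g i.+1 j) \Po 'X^(i.+1)).
have QE t : (t <= d)%N -> Q`_t = #|[set la : Par t | (k <= mult n la)%N]|%:R.
  move=> td; rewrite coef_euler_prod // -sum1_card natr_sum [RHS]big_mkcond /=.
  apply: eq_bigr => la _; rewrite inE.
  pose a : rat := (k <= mult n la)%N%:R.
  transitivity (\prod_(i < d) (if i.+1 == n then a * 1 else 1)).
    by apply: eq_bigr => i _; rewrite /g mulr1; case: eqP => // ->.
  by rewrite (prod_mul_at _ (fun=> 1)) // big1 // mulr1 /a; case: ifP.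
have QP : eqX d Q ('X^(n * k) * Par_gen d).
  pose b i := geom d \Po 'X^i.
  apply: (eqX_trans _ (eqX_mul (@eqX_refl _ d _) (eqX_sym (@Par_gen_prod d)))).
  rewrite -(prod_mul_at _ b nd); apply: eqX_prod => i _.
  rewrite /g /b; case: eqP => [<-|_]; last exact: eqX_refl.
  rewrite exprM -(comp_Xn_poly 'X^(i.+1) k) -comp_polyM.
  exact/eqX_comp/geom_shift.
transitivity ((Q * Par_gen d ^+ m)`_d).
  rewrite coefM big_ord_recl /= QE //.
  (* The convolution also has a term at 0, absent from the sum; it vanishes because [k] is
     positive. *)
  have -> : [set la : Par 0 | (k <= mult n la)%N] = set0.
    apply/setP => la; rewrite !inE; apply/negbTE; rewrite -ltnNge.
    exact: leq_ltn_trans (Par_mult_le la n) k0.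
  rewrite cards0 mul0r add0r natr_sum big_add1 /= big_mkord.
  apply: eq_bigr => i _; rewrite natrM QE; last exact: ltn_ord.
  by rewrite (@u_coef d) // leq_subr.
rewrite (eqX_mul QP (@eqX_refl _ d (Par_gen d ^+ m))) // -mulrA -exprS coefXnM.
case: leqP => [nkd|//]; by rewrite (@u_coef d) // leq_subr.
Qed.

(** The coefficient for [j.+1] simplifies to ['C(j.+1 + m, j)], which is the coefficient of degree
    [j] in [geom D ^+ m.+2]. *)
Lemma geom_exp_shift D m :
  eqX D (\poly_(j < D.+1) (j%:R / m.+1%:R * 'C(j + m, j)%:R))
        ('X * geom D ^+ m.+2).
Proof.
move=> [|j] jD; rewrite coefXM coef_poly ltnS jD /=; first by rewrite !mul0r.
rewrite (@geom_exp D m.+1) ?(ltnW jD) // coef_poly ltnS (ltnW jD).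
rewrite mulrAC -natrM mul_bin_left.
have -> : (j.+1 + m - j)%N = m.+1 by lia.
rewrite natrM mulrAC divff ?mul1r ?pnatr_eq0 //.
by rewrite addSnnS.
Qed.

Lemma Nexp_u l d s : (1 < l)%N -> (0 < s <= d)%N ->
  Nexp l d s = (\sum_(1 <= j < d.+1 | s * j <= d) u (l - 1) (d - s * j))%N%:R.
Proof.
case: l => [|[|m]] // _ sd.
have -> : (m.+2 - 1 = m.+1)%N by lia.
(* With [l = m.+2], each part size contributes [geom d ^+ m.+1]; the weight [mult s la / (l - 1)] at
   part size [s] adds one more geometric factor and a shift by [s]. *)
pose g i j : rat := if i == s then j%:R / m.+1%:R * 'C(j + m, j)%:R
  else 'C(j + m, j)%:R.
pose Q := \prod_(i < d) ((\poly_(j < d.+1) g i.+1 j) \Po 'X^(i.+1)).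
transitivity Q`_d.
  rewrite coef_euler_prod //; apply: eq_bigr => la _.
  rewrite big_add1 /= big_mkord.
  pose b i : rat := 'C(mult i la + m.+2 - 2, mult i la)%:R.
  rewrite -(prod_mul_at _ b sd); apply: eq_bigr => i _.
  rewrite /g /b.
  have -> k : (k + m.+2 - 2 = k + m)%N by lia.
  have -> : (m.+2 - 1 = m.+1)%N by lia.
  by case: eqP => // ->.
have QP : eqX d Q ((\sum_(j < d) 'X^(s * j.+1)) * Par_gen d ^+ m.+1).
  pose b i := geom d ^+ m.+1 \Po 'X^i.
  have Pb : eqX d (\prod_(i < d) b i.+1) (Par_gen d ^+ m.+1).
    apply: (eqX_trans _ (eqX_exp m.+1 (eqX_sym (@Par_gen_prod d)))).
    rewrite -prodrXl; apply: eqX_prod => i _.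
    by rewrite /b rmorphXn; exact: eqX_refl.
  have Ss : eqX d ('X^s * (geom d \Po 'X^s)) (\sum_(j < d) 'X^(s * j.+1)).
    have -> : \sum_(j < d) 'X^(s * j.+1)
      = 'X^s * ((\poly_(j < d) 1) \Po 'X^s) :> {poly rat}.
      rewrite poly_def rmorph_sum mulr_sumr /=; apply: eq_bigr => j _.
      by rewrite scale1r rmorphXn /= comp_polyX -exprM -exprD mulnS.
    (* The last term of [geom d], missing from the sum over [j < d], lands in degree [s * d.+1],
       beyond [d]. *)
    move=> k kd; rewrite !coefXnM; case: ltnP => // sk.
    have s0 : (0 < s)%N by case/andP: sd.
    rewrite !coef_comp_poly_Xn //; case: ifP => // _; rewrite !coef_poly.
    have kd' : ((k - s) %/ s < d)%N.
      by apply: leq_ltn_trans (leq_div _ _) _; lia.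
    by rewrite kd' ltnS (ltnW kd').
  apply: (eqX_trans _ (eqX_mul Ss Pb)).
  rewrite -(prod_mul_at _ b sd); apply: eqX_prod => i _.
  rewrite /g /b; case: eqP => [<-|_]; last first.
    exact/eqX_comp/eqX_sym/geom_exp.
  rewrite -mulrA.
  have -> : 'X^(i.+1) * ((geom d \Po 'X^(i.+1)) * (geom d ^+ m.+1 \Po 'X^(i.+1)))
    = ('X * geom d ^+ m.+2) \Po 'X^(i.+1).
    by rewrite [geom d ^+ m.+2]exprS !comp_polyM comp_polyX.
  exact/eqX_comp/geom_exp_shift.
rewrite QP // mulr_suml coef_sum natr_sum big_add1 /= big_mkord.
rewrite [RHS]big_mkcond /=; apply: eq_bigr => j _.
rewrite coefXnM; case: leqP => // _.
by rewrite (@u_coef d) // leq_subr.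
Qed.

(** * The product over the divisors of N *)

Definition qnum (t : nat) : {fraction {poly int}} := vv ^+ t - vv ^- t.

Lemma vv_neq0 : vv != 0.
Proof. by rewrite tofrac_eq0 polyX_eq0. Qed.

Lemma qnum_neq0 t : (0 < t)%N -> qnum t != 0.
Proof.
move=> t0; rewrite subr_eq0; apply/eqP => eq_t.
have : vv ^+ (t + t) = 1.
  by rewrite exprD {1}eq_t mulVf // expf_neq0 // vv_neq0.
rewrite -rmorphXn -(rmorph1 (@tofrac _)) => /eqP; rewrite tofrac_eq => /eqP.
by move/(congr1 (fun q : {poly int} => size q)); rewrite size_polyXn size_poly1; lia.
Qed.

Lemma qint_mul n s : qint n s * qnum s = qnum (n * s).
Proof.
pose x := vv ^ s%:Z.
have x0 : x != 0 by rewrite expfz_neq0 // vv_neq0.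
(* Multiplying the term of index [k] by [x - x^-1] gives [f k.+1 - f k], so the sum telescopes. *)
pose f (k : nat) := - x ^ (n%:Z + 2 - 2 * k%:Z).
transitivity (\sum_(1 <= k < n.+1) (f k.+1 - f k)).
  rewrite mulr_suml; apply: eq_bigr => k _; rewrite /f opprK addrC.
  have -> : qnum s = x - x^-1 by rewrite /qnum /x.
  rewrite [_ * s%:Z]mulrC -exprz_exp -/x mulrBr.
  rewrite -[X in _ * X - _]expr1z -exprN1 -!expfzDr //.
  by rewrite [LHS]addrC; congr (- (x ^ _) + x ^ _); lia.
rewrite telescope_sumr // /f opprK addrC /qnum exprnN exprnP /x !exprz_exp.
by congr (vv ^ _ - vv ^ _); lia.
Qed.

Lemma qintE n s : (0 < s)%N -> qint n s = qnum (n * s) / qnum s.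
Proof. by move=> s0; rewrite -qint_mul mulfK // qnum_neq0. Qed.

Lemma big_involution (R : Type) (idx : R) (op : Monoid.com_law idx)
    (I : eqType) (s : seq I) (h : I -> I) (F : I -> R) :
    uniq s -> {in s, forall x, h x \in s} -> {in s, involutive h} ->
  \big[op/idx]_(x <- s) F (h x) = \big[op/idx]_(x <- s) F x.
Proof.
move=> us hs hK; rewrite -(big_map h xpredT F); apply/perm_big/uniq_perm => //.
  rewrite map_inj_in_uniq // => x y xs ys eq_h.
  by rewrite -(hK x xs) eq_h hK.
move=> x; apply/mapP/idP => [[y ys ->]|xs]; first exact: hs.
by exists (h x); rewrite ?hs ?hK.
Qed.

(* An involution of the divisors n of N: it exchanges the prime-to-p parts of n
   and N / n and keeps the p-part of n. *)
Definition pswap (p N n : nat) : nat := ((N %/ n)`_p^' * n`_p)%N.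

Lemma pswap_part p n k : (0 < n)%N -> (0 < k)%N ->
  (pswap p (n * k) n = k`_p^' * n`_p)%N.
Proof. by move=> n0 k0; rewrite /pswap mulKn. Qed.

Lemma pswap_dvd p N n : (0 < N)%N -> (n %| N)%N -> (pswap p N n %| N)%N.
Proof.
move=> N0 /dvdnP[k Nk]; move: N0; rewrite {N}Nk muln_gt0 mulnC => /andP[k0 n0].
by rewrite pswap_part // [(n * k)%N]mulnC dvdn_mul ?dvdn_part.
Qed.

(** Since the [p]-part is kept, the swap preserves the set of divisors not divisible by a given
    power of [p]. *)
Lemma logn_pswap p N n : prime p -> (0 < N)%N -> (n %| N)%N ->
  logn p (pswap p N n) = logn p n.
Proof.
move=> p_pr N0 /dvdnP[k Nk]; move: N0; rewrite {N}Nk muln_gt0 mulnC => /andP[k0 n0].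
rewrite pswap_part // lognM ?part_gt0 // logn_part.
by rewrite logn_coprime // prime_coprime // -p'natE // part_pnat.
Qed.

Lemma pswapK p N n : prime p -> (0 < N)%N -> (n %| N)%N ->
  pswap p N (pswap p N n) = n.
Proof.
move=> p_pr N0 /dvdnP[k Nk]; move: N0; rewrite {N}Nk muln_gt0 mulnC => /andP[k0 n0].
rewrite (pswap_part p n0 k0).
(* The first factor is the swapped divisor and the second its cofactor, so [pswap_part] applies
   again. *)
have -> : (n * k = (k`_p^' * n`_p) * (n`_p^' * k`_p))%N.
  by rewrite -[in LHS](partnC p n0) -[in LHS](partnC p k0); ring.
rewrite pswap_part ?muln_gt0 ?part_gt0 // !partnM ?part_gt0 //.
have part' m : (m`_p`_p^' = 1)%N by apply: part_p'nat; rewrite pnatNK part_pnat.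
have part'' m : (m`_p^'`_p = 1)%N by apply: part_p'nat; rewrite part_pnat.
rewrite part' part'' muln1 mul1n !(part_pnat_id (part_pnat _ _)).
by rewrite mulnC partnC.
Qed.

Definition Ifactor (p r n k : nat) : {fraction {poly int}} :=
  qint (p ^ (r + logn p k - logn p n)) (k`_p^' * p ^ logn p n).

Lemma prod_divisors_qint p r N : prime p -> (0 < N)%N ->
  \prod_(n <- divisors N | ~~ (p ^ r %| n)%N) Ifactor p r n (N %/ n)%N
    = \prod_(n <- divisors N) qint (p ^ r) n.
Proof.
move=> p_pr N0; set l := (p ^ r)%N.
have l0 : (0 < l)%N by rewrite expn_gt0 prime_gt0.
have div_gt0 n : n \in divisors N -> (0 < n)%N.
  by rewrite -dvdn_divisors // => /dvdn_gt0; apply.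
have codiv_gt0 n : n \in divisors N -> (0 < N %/ n)%N.
  by move=> nN; rewrite divn_gt0 ?div_gt0 // dvdn_leq // dvdn_divisors.
have -> : \prod_(n <- divisors N | ~~ (l %| n)%N) Ifactor p r n (N %/ n)%N
   = \prod_(n <- divisors N | ~~ (l %| n)%N) 
       (qnum (l * (N %/ n)) / qnum (pswap p N n)).
  rewrite big_seq_cond [RHS]big_seq_cond; apply: eq_bigr => n /andP[nN ln].
  have n0 := div_gt0 n nN; have k0 := codiv_gt0 n nN.
  (* This makes the truncated subtraction in the exponent exact; the numerator index then recombines
     to [l * (N %/ n)]. *)
  have nr : (logn p n < r)%N by move: ln; rewrite pfactor_dvdn // -ltnNge.
  rewrite /Ifactor /pswap p_part qintE ?muln_gt0 ?part_gt0 ?expn_gt0 ?prime_gt0 //.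
  congr (qnum _ / _).
  rewrite mulnCA -expnD subnK; last by rewrite (leq_trans (ltnW nr)) ?leq_addr.
  by rewrite expnD -p_part mulnCA [(_`_p^' * _)%N]mulnC partnC.
have -> : \prod_(n <- divisors N) qint l n
  = \prod_(n <- divisors N) (qnum (l * n) / qnum n).
  by rewrite big_seq [RHS]big_seq; apply: eq_bigr => n /div_gt0; apply: qintE.
have uF P : uniq [seq n <- divisors N | P n] by rewrite filter_uniq ?divisors_uniq.
have co : \prod_(n <- divisors N) qnum (l * (N %/ n))
    = \prod_(n <- divisors N) qnum (l * n).
  apply: (big_involution _ (fun n => qnum (l * n))) (divisors_uniq N) _ _.
    by move=> n; rewrite -!dvdn_divisors //; exact: dvdn_div.
  move=> n; rewrite -dvdn_divisors // => nN.
  by rewrite divnA ?mulKn.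
have sw : \prod_(n <- divisors N | ~~ (l %| n)%N) qnum (pswap p N n)
    = \prod_(n <- divisors N | ~~ (l %| n)%N) qnum n.
  rewrite -big_filter -[RHS]big_filter.
  apply: (big_involution _ _ (uF _)) => n.
    rewrite !mem_filter -!dvdn_divisors // => /andP[ln nN].
    rewrite pswap_dvd // andbT pfactor_dvdn ?logn_pswap -?pfactor_dvdn //.
      exact: dvdn_gt0 nN.
    by apply: dvdn_gt0 (pswap_dvd _ _ nN).
  by rewrite mem_filter -dvdn_divisors // => /andP[_ nN]; rewrite pswapK.
(* On the divisors [n] of [N] that are multiples of [l], the map [n |-> l * (N / n)] is an
   involution. *)
have li : \prod_(n <- divisors N | (l %| n)%N) qnum (l * (N %/ n))
    = \prod_(n <- divisors N | (l %| n)%N) qnum n.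
  rewrite -big_filter -[RHS]big_filter.
  apply: (big_involution _ qnum (h := fun n => l * (N %/ n))%N (uF _)) => n.
    rewrite !mem_filter -!dvdn_divisors // => /andP[ln nN].
    apply/andP; split; first exact: dvdn_mulr.
    by rewrite -{2}(divnK nN) mulnC dvdn_pmul2l // codiv_gt0 // -dvdn_divisors.
  rewrite mem_filter -dvdn_divisors // => /andP[/dvdnP[m ->] /dvdnP[k Nk]].
  move: N0; rewrite Nk !muln_gt0 => /and3P[k0 m0 _].
  have -> : (k * (m * l) = m * (l * k))%N by ring.
  rewrite [X in (l * (m * _ %/ (l * X)))%N](_ : _ = k) ?mulnK ?muln_gt0 ?l0 //.
    exact: mulnC.
  have -> : (m * (l * k) = k * (m * l))%N by ring.
  by rewrite mulnK // muln_gt0 m0.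
have nz (P : pred nat) (h : nat -> nat) :
    {in divisors N, forall n, 0 < h n}%N ->
  \prod_(n <- divisors N | P n) qnum (h n) != 0.
  move=> h0; rewrite prodf_seq_neq0; apply/allP => n nN; apply/implyP => _.
  exact/qnum_neq0/h0.
(* On the right, numerator and denominator are split by divisibility by [l]. By [li] their parts
   with [l] dividing [n] agree, and they cancel because they are nonzero. *)
rewrite !big_split /= !prodfV sw -co.
rewrite [\prod_(n <- _) qnum (l * _)](bigID (fun n => l %| n)%N) /= li.
rewrite [\prod_(n <- divisors N) qnum n](bigID (fun n => l %| n)%N) /=.
rewrite invfM mulrACA divff ?mul1r // nz // => n /div_gt0.
Qed.

(** * Rearranging the double products and conclusion *)

Lemma prod_by_product (R : Type) (idx : R) (op : Monoid.com_law idx) d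
    (P : pred nat) (F : nat -> nat -> R) :
  \big[op/idx]_(1 <= n < d.+1 | P n)
     \big[op/idx]_(1 <= k < d.+1 | (n * k <= d)%N) F n k
    = \big[op/idx]_(1 <= N < d.+1)
        \big[op/idx]_(n <- divisors N | P n) F n (N %/ n)%N.
Proof.
transitivity (\big[op/idx]_(1 <= N < d.+1)
   \big[op/idx]_(1 <= n < d.+1 | P n && (n %| N)%N) F n (N %/ n)%N); last first.
  apply: eq_big_nat => N /andP[N0 Nd].
  rewrite -big_filter -[RHS]big_filter; apply/perm_big/uniq_perm.
  - by rewrite filter_uniq ?iota_uniq.
  - by rewrite filter_uniq ?divisors_uniq.
  move=> n; rewrite !mem_filter mem_index_iota -dvdn_divisors // -andbA.
  congr (_ && _); apply: andb_idr => nN.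
  by rewrite (dvdn_gt0 N0 nN) (leq_ltn_trans (dvdn_leq N0 nN)).
(* With [n] outermost, the inner index runs over the multiples [N = n * k] of [n] up to [d]. *)
rewrite [RHS](exchange_big_dep P) /=; last by move=> N n _ /andP[].
rewrite big_nat_cond [RHS]big_nat_cond; apply: eq_bigr => n /andP[/andP[n0 _] Pn].
rewrite [RHS](eq_bigl (fun N => n %| N)%N); last by move=> N; rewrite Pn.
rewrite -big_filter -[RHS]big_filter.
have Enk : perm_eq [seq N <- index_iota 1 d.+1 | n %| N]%N
  [seq (n * k)%N | k <- [seq k <- index_iota 1 d.+1 | n * k <= d]%N].
  apply: uniq_perm.
  - by rewrite filter_uniq ?iota_uniq.
  - rewrite map_inj_uniq ?filter_uniq ?iota_uniq // => x y /eqP.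
    by rewrite eqn_pmul2l // => /eqP.
  move=> N; rewrite mem_filter mem_index_iota; apply/idP/mapP.
    case/and3P => /dvdnP[k ->] kn0 kd; exists k; rewrite 1?mulnC //.
    rewrite mem_filter mem_index_iota; move: kn0 kd.
    by rewrite muln_gt0 mulnC => /andP[-> _] kd /=; nia.
  case=> k; rewrite mem_filter mem_index_iota => /and3P[kd k0 _] ->.
  by rewrite dvdn_mulr // muln_gt0 n0 k0.
by rewrite [RHS](perm_big _ Enk) big_map; apply: eq_bigr => k _; rewrite mulKn.
Qed.

(** Ranges independent of [la] allow the products over [la], [n] and [k] to be exchanged. The added
    values [n > s] have multiplicity 0 and contribute 1. *)
Lemma Iv_widen p r d s (la : Par s) : (s <= d)%N ->
  Iv p r la = \prod_(1 <= n < d.+1 | ~~ (p ^ r %| n)%N)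
    \prod_(1 <= k < d.+1 | (k <= mult n la)%N)
      Ifactor p r n k.
Proof.
move=> sd; rewrite /Iv Par_sumn.
rewrite [RHS](@big_cat_nat _ _ _ s.+1) //= [X in _ * X]big_nat_cond.
rewrite [X in _ * X]big1 ?mulr1 => [|n /andP[/andP[sn _] _]]; last first.
  rewrite Par_mult_eq0 // big_nat_cond big1 // => k /andP[/andP[k0 _]].
  by rewrite leqNgt k0.
apply: eq_bigr => n _; have md := leq_trans (Par_mult_le la n) sd.
rewrite [RHS](@big_cat_nat _ _ _ (mult n la).+1) //= [X in _ * X]big_nat_cond.
rewrite [X in _ * X]big1 ?mulr1 => [|k /andP[/andP[mk _]]]; last first.
  by rewrite leqNgt mk.
rewrite big_nat_cond [RHS]big_nat_cond; apply: eq_bigl => k.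
by rewrite ltnS; case: (k <= mult n la)%N; rewrite ?andbT ?andbF.
Qed.

Theorem theorem7p20 (p r l : nat) (hp : prime p) (hr : (1 <= r)%N)
    (hl : l = (p ^ r)%N) (d : nat) :
  \prod_(1 <= s < d.+1) qint l s ^+ Num.truncn (Nexp l d s) =
  \prod_(1 <= s < d.+1) \prod_(la : Par s) Iv p r la ^+ u (l - 2) (d - s).
Proof.
have l1 : (1 < l)%N by rewrite hl -(exp1n r) ltn_exp2r // prime_gt1.
transitivity (\prod_(1 <= N < d.+1)
  \prod_(s <- divisors N) qint l s ^+ u (l - 1) (d - N)).
  transitivity (\prod_(1 <= s < d.+1) \prod_(1 <= j < d.+1 | (s * j <= d)%N)
    qint l s ^+ u (l - 1) (d - s * j)).
    apply: eq_big_nat => s sd; rewrite Nexp_u // natrK.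
    by rewrite -prodrXr.
  rewrite (prod_by_product _ d predT
    (fun s j => qint l s ^+ u (l - 1) (d - s * j))).
  apply: eq_big_nat => N /andP[N0 _]; rewrite big_seq [RHS]big_seq.
  by apply: eq_bigr => s; rewrite -dvdn_divisors // => sN; rewrite mulnC divnK.
(* For each [N] the divisor identity is raised to the power [u (l - 1) (d - N)], which depends on
   [N] alone. *)
transitivity (\prod_(1 <= n < d.+1 | ~~ (l %| n)%N)
    \prod_(1 <= k < d.+1 | (n * k <= d)%N) Ifactor p r n k ^+ u (l - 1) (d - n * k)).
  rewrite (prod_by_product _ d (fun n => ~~ (l %| n)%N)
    (fun n k => Ifactor p r n k ^+ u (l - 1) (d - n * k))).
  apply: eq_big_nat => N /andP[N0 _].
  rewrite prodrXl hl -(prod_divisors_qint r hp N0) -hl -prodrXl.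
  rewrite big_seq_cond [RHS]big_seq_cond.
  apply: eq_bigr => n /andP[]; rewrite -dvdn_divisors // => nN _.
  by rewrite [(n * _)%N]mulnC divnK.
symmetry.
(* The condition on [k] moves into the exponent as a factor 0 or 1. Once [n] and [k] are outermost,
   the exponents add up to the sum in [count_mult_geq_u]. *)
transitivity (\prod_(1 <= s < d.+1) \prod_(la : Par s)
   \prod_(1 <= n < d.+1 | ~~ (l %| n)%N) \prod_(1 <= k < d.+1)
     Ifactor p r n k ^+ ((k <= mult n la) * u (l - 2) (d - s))).
  apply: eq_big_nat => s /andP[_ sd]; apply: eq_bigr => la _.
  rewrite (@Iv_widen p r d) // -hl -prodrXl; apply: eq_bigr => n _.
  rewrite -prodrXl big_mkcond; apply: eq_bigr => k _.
  by case: (k <= mult n la)%N; rewrite ?mul1n.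
under eq_bigr do rewrite exchange_big.
rewrite exchange_big big_nat_cond [RHS]big_nat_cond.
apply: eq_bigr => n /andP[nd _].
under eq_bigr do rewrite exchange_big.
rewrite exchange_big [RHS]big_mkcond /=; apply: eq_big_nat => k /andP[k0 _].
under eq_bigr do rewrite prodrXr.
rewrite prodrXr.
have -> : (l - 1 = (l - 2).+1)%N by lia.
transitivity (Ifactor p r n k ^+ (if n * k <= d then u (l - 2).+1 (d - n * k) else 0)%N);
  last by case: ifP.
rewrite -(count_mult_geq_u (l - 2) nd k0); congr (_ ^+ _).
apply: eq_bigr => t _; rewrite -big_distrl /=; congr (_ * _)%N.
by rewrite -sum1_card [RHS]big_mkcond; apply: eq_bigr => la _; rewrite inE; case: ifP.
Qed.
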